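(* Let $\mathcal{H},\mathcal{K}$ be complex separable Hilbert spaces, $\delta\in\mathcal{H}$ a unit vector, $q=|\delta\rangle\langle\delta|\otimes\mathbf{1}$ the orthogonal projection of $\mathcal{H}\otimes\mathcal{K}$ onto $\delta\otimes\mathcal{K}\simeq\mathcal{K}$, and $(\gamma_t)_{t\ge0}$ an $E_0$-semigroup on $\mathcal{B}(\mathcal{K})$. If an $(\mathrm{Id}\otimes\gamma_t)$-cocycle $(u_t)_{t\ge0}$ is convergent and $u_t^*\to\hat w$ (strongly, as $t\to\infty$) with $\hat w\hat w^*=q$, then $(u_t)$ is exact with respect to $\mathcal{K}$.
   Context: An $E_0$-semigroup on $\mathcal{B}(\mathcal{L})$ ($\mathcal{L}$ a complex separable Hilbert space) is a pointwise weak$^*$-continuous one-parameter semigroup $(\beta_t)_{t\ge0}$ (with $\beta_0$ the identity) of normal unital $*$-endomorphisms of $\mathcal{B}(\mathcal{L})$. $\mathrm{Id}\otimes\gamma_t$, with $\mathrm{Id}$ the identity map of $\mathcal{B}(\mathcal{H})$, is the amplification of $\gamma_t$ to $\mathcal{B}(\mathcal{H}\otimes\mathcal{K})$. For an $E_0$-semigroup $(\beta_t)$ on $\mathcal{B}(\mathcal{L})$, a $(\beta_t)$-cocycle is a strongly continuous family $(u_t)_{t\ge0}$ of unitaries on $\mathcal{L}$ with $u_0=\mathbf{1}$ and $u_{t+s}=u_t\beta_t(u_s)$ for all $s,t\ge0$; it is convergent if $u_t^*$ converges in the strong operator topology as $t\to\infty$. An $(\mathrm{Id}\otimes\gamma_t)$-cocycle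 $(u_t)$ is exact with respect to $\mathcal{K}$ if there is an isometry $\hat w\in\mathcal{B}(\mathcal{H}\otimes\mathcal{K})$ onto $\mathcal{K}\simeq\delta\otimes\mathcal{K}$ (i.e. $\hat w^*\hat w=\mathbf{1}$, $\hat w\hat w^*=q$) such that $u_t=\hat w^*\,(\mathrm{Id}\otimes\gamma_t)(\hat w)$ for all $t\ge0$. *)

(* Defs.v *)
From HB Require Import structures.
From mathcomp Require Import all_boot all_order all_algebra.
From mathcomp Require Import all_classical all_reals all_analysis.
From mathcomp Require Import complex sesquilinear ring.

Set Implicit Arguments.
Unset Strict Implicit.
Unset Printing Implicit Defensive.
Import Order.TTheory GRing.Theory Num.Theory numFieldNormedType.Exports.

Local Open Scope classical_set_scope.
Local Open Scope ring_scope.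

(* Packing R[i] as a numClosedFieldType gives it MathComp-Analysis's norm
   topology, which is not inferred for the bare notation R[i]. *)
Definition Cplx (R : realType) : numClosedFieldType := R[i]%C.

(* As usual in MathComp, the norm of a complex normed module takes values in
   the nonnegative elements of the scalar field. *)
HB.mixin Record CompleteNormedModule_isHilbert (R : realType) H
    & CompleteNormedModule (Cplx R) H := {
  inner : H -> H -> Cplx R ;
  inner_linearl : forall (a : Cplx R) (x y z : H),
    inner (a *: x + y) z = a * inner x z + inner y z ;
  inner_conj : forall x y : H, inner x y = (inner y x)^* ;
  innerxx : forall x : H, inner x x = `|x| ^+ 2
}.

#[short(type="hilbertType")]
HB.structure Definition Hilbert (R : realType) :=
  {H of CompleteNormedModule_isHilbert R H & CompleteNormedModule (Cplx R) H}.

Section InnerDot.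
Context {R : realType} {H : hilbertType R}.

Let inner_bilinear :
  bilinear_for ( *%R ) (Num.conj \; *%R) (@inner R H).
Proof.
split=> [z a x y|z a x y] /=; first exact: inner_linearl.
by rewrite [LHS]inner_conj inner_linearl rmorphD rmorphM/= -!inner_conj.
Qed.

HB.instance Definition _ := bilinear_isBilinear.Build (Cplx R) H H (Cplx R)
  ( *%R ) (Num.conj \; *%R) (@inner R H) inner_bilinear.

Let inner_hermitian (x y : H) : inner x y = (-1) ^+ false * Num.conj (inner y x).
Proof. by rewrite expr0 mul1r -inner_conj. Qed.

HB.instance Definition _ := isHermitianSesquilinear.Build (Cplx R) H false
  Num.conj (@inner R H) inner_hermitian.

Let inner_gt0 (x : H) : x != 0 -> 0 < inner x x.
Proof. by move=> x0; rewrite innerxx exprn_gt0 ?normr_gt0. Qed.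

HB.instance Definition _ := isDotProduct.Build (Cplx R) H (@inner R H) inner_gt0.

End InnerDot.

Definition separable_space (T : topologicalType) :=
  exists2 S : set T, countable S & dense S.

Section BoundedOperators.
Context {K : numFieldType}.

Definition bounded_linear (V W : normedModType K) : {pred V -> W} :=
  mem [set f : V -> W | linear f /\ continuous f].

Record bop (V W : normedModType K) :=
  Bop { bop_fun :> V -> W ; bop_subproof : bop_fun \in @bounded_linear V W }.

Section Lmodule.
Variables V W : normedModType K.

HB.instance Definition _ := [isSub for @bop_fun V W].
HB.instance Definition _ := [Choice of bop V W by <:].

Lemma bopP (f : bop V W) : linear f /\ continuous f.
Proof. by case: f => f /= /set_mem. Qed.

Lemma bop_ext (f g : bop V W) : f =1 g -> f = g.
Proof. by move=> fg; apply/val_inj/funext. Qed.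

Lemma bounded_linear_submod : submod_closed (@bounded_linear V W).
Proof.
split=> [|a f g /set_mem[lf cf] /set_mem[lg cg]]; apply/mem_set; split.
- by move=> a x y; rewrite scaler0 addr0.
- exact: cst_continuous.
- move=> b x y; change (a *: f (b *: x + y) + g (b *: x + y) =
    b *: (a *: f x + g x) + (a *: f y + g y)).
  by rewrite lf lg !scalerDr !scalerA mulrC addrACA.
- by move=> x; apply: cvgD; [apply: cvgZr; exact: cf|exact: cg].
Qed.

HB.instance Definition _ :=
  GRing.isSubmodClosed.Build _ _ (@bounded_linear V W) bounded_linear_submod.
HB.instance Definition _ := [SubChoice_isSubLmodule of bop V W by <:].
HB.instance Definition _ (f : bop V W) :=
  GRing.isLinear.Build K V W *:%R f (bopP f).1.

End Lmodule.

Section Ring.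
Variable V : normedModType K.

Lemma bop_id_subproof : @idfun V \in @bounded_linear V V.
Proof. by apply/mem_set; split=> // x; exact: cvg_id. Qed.

Definition bop_id : bop V V := Bop bop_id_subproof.

Lemma bop_comp_subproof (f g : bop V V) : f \o g \in @bounded_linear V V.
Proof.
have [[lf cf] [lg cg]] := (bopP f, bopP g).
apply/mem_set; split=> [a x y /=|x]; first by rewrite lg lf.
by apply: continuous_comp; [exact: cg|exact: cf].
Qed.

Definition bop_comp (f g : bop V V) : bop V V := Bop (bop_comp_subproof f g).

Lemma bop_compA : associative bop_comp.
Proof. by move=> f g h; exact: bop_ext. Qed.

Lemma bop_comp1f : left_id bop_id bop_comp.
Proof. by move=> f; exact: bop_ext. Qed.

Lemma bop_compf1 : right_id bop_id bop_comp.
Proof. by move=> f; exact: bop_ext. Qed.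

Lemma bop_compDl : left_distributive bop_comp +%R.
Proof. by move=> f g h; exact: bop_ext. Qed.

Lemma bop_compDr : right_distributive bop_comp +%R.
Proof.
move=> f g h; apply: bop_ext => x /=; have [lf _] := bopP f.
by have := lf 1 (g x) (h x); rewrite !scale1r.
Qed.

(* Not an nzRingType: V may be the zero space. *)
HB.instance Definition _ := GRing.Zmodule_isPzRing.Build (bop V V)
  bop_compA bop_comp1f bop_compf1 bop_compDl bop_compDr.

End Ring.

End BoundedOperators.

Section HilbertOperators.
Context {R : realType}.

Lemma inner_Cauchy_Schwarz (H : hilbertType R) (x y : H) :
  `|inner x y| <= `|x| * `|y|.
Proof.
have [->|y0] := eqVneq y 0.
  rewrite (_ : inner x 0 = 0) ?normr0 ?mulr0//.
  by rewrite -(subrr (0 : H)) linearBr subrr.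
have y2 : 0 < `|y| ^+ 2 by rewrite exprn_gt0 ?normr_gt0.
rewrite -ler_sqr ?nnegrE ?mulr_ge0 ?normr_ge0// exprMn.
rewrite -(ler_pM2l y2) -subr_ge0.
pose a := inner x y; pose z := `|y| ^+ 2 *: x - a *: y.
suff -> : `|y| ^+ 2 * (`|x| ^+ 2 * `|y| ^+ 2) - `|y| ^+ 2 * `|a| ^+ 2 = `|z| ^+ 2.
  by rewrite exprn_ge0.
have Zl (c : Cplx R) (v w : H) : inner (c *: v) w = c * inner v w.
  exact: linearZl_LR.
have Zr (c : Cplx R) (v w : H) : inner v (c *: w) = c^* * inner v w.
  exact: linearZr_LR.
have Bl (v w t : H) : inner (v - w) t = inner v t - inner w t.
  exact: linearBl.
have Br (v w t : H) : inner t (v - w) = inner t v - inner t w.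
  exact: linearBr.
rewrite -[RHS]innerxx /z Bl !Br !Zl !Zr !innerxx (inner_conj y x).
have -> : (`|y| ^+ 2)^* = `|y| ^+ 2 by apply/CrealP; rewrite rpredX ?normr_real.
rewrite normCK -/a.
by ring.
Qed.

Lemma ketbra_subproof (H : hilbertType R) (d : H) :
  (fun x => inner x d *: d) \in @bounded_linear (Cplx R) H H.
Proof.
have lin : linear (fun x : H => inner x d *: d).
  by move=> a x y; rewrite linearDl linearZl_LR scalerDl scalerA.
apply/mem_set; split=> // x.
pose f := HB.pack_for {linear H -> H} (fun x : H => inner x d *: d)
  (GRing.isLinear.Build _ _ _ _ _ lin).
apply: (@bounded_linear_continuous _ _ _ f).
apply/linear_boundedP; exists (`|d| * `|d|); split.
  by rewrite realM ?normr_real.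
move=> M dM y; rewrite /= normrZ.
rewrite (le_trans (ler_wpM2r (normr_ge0 d) (inner_Cauchy_Schwarz y d)))//.
by rewrite -mulrA mulrC ler_wpM2r// ltW.
Qed.

(* The operator |d><d|. *)
Definition ketbra (H : hilbertType R) (d : H) : bop H H :=
  Bop (ketbra_subproof d).

(* The adjoint; it exists by the Riesz representation theorem. *)
Definition adj (H : hilbertType R) (X : bop H H) : bop H H :=
  xget 0 [set Y : bop H H | forall x y, inner (X x) y = inner x (Y y)].

Definition unitary (H : hilbertType R) (U : bop H H) :=
  adj U * U = 1 /\ U * adj U = 1.

Definition square_summable (H : hilbertType R) (x : nat -> H) :=
  cvgn (series (fun n => `|x n| ^+ 2)).

(* The functionals X |-> \sum_n <X x_n, y_n> with x, y square-summable are the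
   elements of the predual of B(H). *)
Definition normal_functional (H : hilbertType R)
    (p : {p : (nat -> H) * (nat -> H) |
           square_summable p.1 /\ square_summable p.2})
    (X : bop H H) : Cplx R :=
  limn (series (fun n => inner (X ((sval p).1 n)) ((sval p).2 n))).

(* B(H) with its weak* (= ultraweak) topology: the coarsest topology for which
   all the normal functionals are continuous. *)
Definition wstar (H : hilbertType R) :=
  initial_topology (fun X : bop H H =>
    (fun p => normal_functional p X) : {ptws _ -> Cplx R}).

HB.instance Definition _ (H : hilbertType R) := Topological.on (wstar H).

Record normal_star_endo (H : hilbertType R) (f : bop H H -> bop H H) : Prop := {
  nse_linear : linear f ;
  nse_unital_mul : monoid_morphism f ;
  nse_star : forall X, f (adj X) = adj (f X) ;
  nse_normal : continuous (f : wstar H -> wstar H)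
}.

(* One-parameter families indexed by t >= 0 are represented by functions on R
   whose values at t < 0 are irrelevant. *)
Record E0_semigroup (H : hilbertType R) (b : R -> bop H H -> bop H H) : Prop := {
  e0_endo : forall t : R, 0 <= t -> normal_star_endo (b t) ;
  e0_id : forall X, b 0 X = X ;
  e0_add : forall s t : R, 0 <= s -> 0 <= t -> forall X, b (s + t) X = b s (b t X) ;
  e0_continuous : forall X,
    {within `[0, +oo[, continuous (fun t => b t X : wstar H)}
}.

Record cocycle (H : hilbertType R) (b : R -> bop H H -> bop H H)
    (u : R -> bop H H) : Prop := {
  cocycle_unitary : forall t : R, 0 <= t -> unitary (u t) ;
  cocycle_continuous : forall x, {within `[0, +oo[, continuous (fun t => u t x)} ;
  cocycle0 : u 0 = 1 ;
  cocycleD : forall s t : R, 0 <= s -> 0 <= t -> u (t + s) = u t * b t (u s)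
}.

Definition adj_sot_limit (H : hilbertType R) (u : R -> bop H H) (w : bop H H) :=
  forall x, adj (u t) x @[t --> +oo] --> w x.

Definition convergent (H : hilbertType R) (u : R -> bop H H) :=
  exists w, adj_sot_limit u w.

(* A Hilbert space tensor product of H and K, which is unique up to a unique
   unitary compatible with the elementary tensors. *)
Record hilbert_tensor (H K : hilbertType R) := HilbertTensor {
  tensor_space :> hilbertType R ;
  tens : {bilinear H -> K -> tensor_space} ;
  inner_tens : forall h h' k k',
    inner (tens h k) (tens h' k') = inner h h' * inner k k' ;
  tens_total :
    dense [set x | exists s : seq (H * K), x = \sum_(p <- s) tens p.1 p.2]
}.

(* The operator A (x) B. *)
Definition op_tens (H K : hilbertType R) (HK : hilbert_tensor H K)
    (A : bop H H) (B : bop K K) : bop HK HK :=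
  xget 0 [set X : bop HK HK | forall h k, X (tens HK h k) = tens HK (A h) (B k)].

(* G is Id (x) g: the unique normal unital *-endomorphism of B(HK) that maps
   A (x) B to A (x) g(B). *)
Definition amplification (H K : hilbertType R) (HK : hilbert_tensor H K)
    (g : bop K K -> bop K K) (G : bop HK HK -> bop HK HK) :=
  normal_star_endo G /\
  forall A B, G (op_tens HK A B) = op_tens HK A (g B).

(* q = |d><d| (x) 1, the orthogonal projection onto d (x) K. *)
Definition proj_slice (H K : hilbertType R) (HK : hilbert_tensor H K) (d : H) :
    bop HK HK :=
  op_tens HK (ketbra d) 1.

(* For a cocycle u with respect to the amplified semigroup G. *)
Definition exact_cocycle (H K : hilbertType R) (HK : hilbert_tensor H K) (d : H)
    (G : R -> bop HK HK -> bop HK HK) (u : R -> bop HK HK) :=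
  exists w : bop HK HK,
    [/\ adj w * w = 1, w * adj w = proj_slice HK d &
        forall t : R, 0 <= t -> u t = adj w * G t w].

End HilbertOperators.

Arguments op_tens {R H K} HK A B.
Arguments amplification {R H K} HK g G.
Arguments proj_slice {R H K} HK d.
Arguments exact_cocycle {R H K} HK d G u.

(* Main.v *)
Require Import Defs.
From HB Require Import structures.
From mathcomp Require Import all_boot all_order all_algebra.
From mathcomp Require Import all_classical all_reals all_analysis.
From mathcomp Require Import complex sesquilinear.
From mathcomp Require Import ring lra.

(* Taking adjoints in the cocycle identity gives
   adj (u (t + s)) = G t (adj (u s)) * adj (u t). The contractions adj (u s)
   tend to w strongly, hence weak*, and G t is normal, so s -> +oo yields
   w = G t w * adj (u t), that is G t w = w * u t. Being a strong limit of
   isometries, w is an isometry, whence u t = adj w * G t w. *)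

Import Order.TTheory GRing.Theory Num.Theory numFieldNormedType.Exports.
Local Open Scope classical_set_scope.
Local Open Scope ring_scope.

Set Implicit Arguments.
Unset Strict Implicit.
Unset Printing Implicit Defensive.

(** * Real parts: order and limits *)

Lemma Re_gt0 (R : realType) (x : Cplx R) : 0 < x -> 0 < complex.Re x.
Proof. by rewrite ltcE => /andP[]. Qed.

Lemma Re_ler (R : realType) (x y : Cplx R) :
  x <= y -> complex.Re x <= complex.Re y.
Proof. by rewrite lecE => /andP[]. Qed.

Lemma Re_le_norm (R : realType) (x : Cplx R) : complex.Re x <= complex.Re `|x|.
Proof.
have := Re_ler (normc_ge_Re x); apply: le_trans.
exact: ler_norm.
Qed.

Lemma Re_lt_real (R : realType) (x y : Cplx R) : x \is Num.real ->
  y \is Num.real -> complex.Re x < complex.Re y -> x < y.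
Proof. by move=> /RRe_real<- /RRe_real<-; rewrite ltcR. Qed.

Lemma Re_natM (R : realType) (n : nat) (x : Cplx R) :
  complex.Re (n%:R * x) = n%:R * complex.Re x.
Proof. by rewrite !mulr_natl raddfMn. Qed.

Lemma Re_cvg (R : realType) (T : Type) (F : set_system T) (FF : Filter F)
    (f : T -> Cplx R) (l : Cplx R) :
  f x @[x --> F] --> l -> complex.Re (f x) @[x --> F] --> complex.Re l.
Proof.
move=> fl; apply/cvgrPdist_lt => e e0.
have e0' : 0 < (e%:C%C : Cplx R) by rewrite ltcR.
have /cvgrPdist_lt/(_ _ e0') := fl.
apply: filterS => x /= h; rewrite -ltcR; apply: le_lt_trans h.
by rewrite -raddfB normc_ge_Re.
Qed.

(** * Inner products and the Riesz representation theorem *)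

Section Inner.
Context {R : realType} {H : hilbertType R}.
Implicit Types (x y z : H) (c : Cplx R).

Lemma innerDl x y z : inner (x + y) z = inner x z + inner y z.
Proof. exact: linearDl. Qed.

Lemma innerDr x y z : inner x (y + z) = inner x y + inner x z.
Proof. exact: linearDr. Qed.

Lemma innerBl x y z : inner (x - y) z = inner x z - inner y z.
Proof. exact: linearBl. Qed.

Lemma innerBr x y z : inner x (y - z) = inner x y - inner x z.
Proof. exact: linearBr. Qed.

Lemma innerZl c x y : inner (c *: x) y = c * inner x y.
Proof. exact: linearZl_LR. Qed.

Lemma innerZr c x y : inner x (c *: y) = c^* * inner x y.
Proof. exact: linearZr_LR. Qed.

Lemma inner_inj x y : (forall z, inner z x = inner z y) -> x = y.
Proof.
move=> xy; apply/eqP; rewrite -subr_eq0 -normr_eq0 -sqrf_eq0 -innerxx.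
by rewrite innerBr xy subrr.
Qed.

Lemma inner_cvgl (T : Type) (F : set_system T) (FF : Filter F)
    (f : T -> H) x y :
  f t @[t --> F] --> x -> inner (f t) y @[t --> F] --> inner x y.
Proof.
move=> fx; apply/cvgrPdist_lt => e e0.
(* Adding 1 keeps the divisor positive when [y = 0]. *)
have y0 : 0 < `|y| + 1 by rewrite ltr_wpDl.
have /cvgrPdist_lt/(_ _ (divr_gt0 e0 y0)) := fx.
apply: filterS => t /=; rewrite ltr_pdivlMr// => h.
rewrite -innerBl (le_lt_trans (inner_Cauchy_Schwarz _ _))//.
by apply: le_lt_trans h; rewrite ler_wpM2l// lerDl.
Qed.

Lemma parallelogram x y :
  `|x - y| ^+ 2 = 2 * `|x| ^+ 2 + 2 * `|y| ^+ 2 - 4 * `|2^-1 *: (x + y)| ^+ 2.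
Proof.
rewrite -!innerxx innerZl innerZr !innerBl !innerBr !innerDl !innerDr.
have -> : (2^-1 : Cplx R)^* = 2^-1 by apply/CrealP; rewrite realV realn.
by field.
Qed.

(* The representing vector minimizes |x|^2 - 2 Re f(x): the parallelogram law
   makes the sublevel sets a Cauchy filter. *)
Lemma riesz_representation (f : H -> (Cplx R)^o) :
  linear f -> continuous f -> exists z, forall x, f x = inner x z.
Proof.
move=> lf cf.
have [C C0 fC] : exists2 C : Cplx R, 0 < C & forall x, `|f x| <= C * `|x|.
  pose g := HB.pack_for {linear H -> (Cplx R)^o} f
    (GRing.isLinear.Build _ _ _ _ _ lf).
  have /linear_boundedP/pinfty_ex_gt0[C C0 gC] : bounded_near g (nbhs 0).
    by apply: continuous_linear_bounded; exact: cf.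
  by exists C.
have fD x y : f (x + y) = f x + f y.
  by have := lf 1 x y; rewrite !scale1r.
have f0 : f 0 = 0 by apply: (addrI (f 0)); rewrite -fD !addr0.
have fZ c x : f (c *: x) = c * f x.
  by have := lf c x 0; rewrite !addr0 f0 addr0.
pose j x : Cplx R := `|x| ^+ 2 - 2 * f x.
pose J x : R := complex.Re (j x).
(* Since [|f x| <= C * |x|], this follows from [0 <= (C - |x|)^2]. *)
have J_ge x : - complex.Re (C ^+ 2) <= J x.
  rewrite /J raddfB /= Re_natM -subr_ge0.
  have := Re_le_norm (f x).
  have /Re_ler := fC x.
  have : 0 <= (C - `|x|) ^+ 2.
    by rewrite real_exprn_even_ge0// rpredB ?normr_real// gtr0_real.
  move=> /Re_ler; rewrite sqrrB -mulr_natl raddfD raddfB /= Re_natM.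
  lra.
pose m := inf (range J).
have mJ x : m <= J x.
  apply: ge_inf; last by exists x.
  by exists (- complex.Re (C ^+ 2)) => _ [y _ <-].
have m_adh (e : R) : 0 < e -> exists x, J x < m + e.
  move=> e0; have [|_ [x _ <-] ?] := @inf_adherent _ (range J) _ e0.
    split; first by exists (J 0), 0.
    by exists (- complex.Re (C ^+ 2)) => _ [y _ <-].
  by exists x.
(* The contributions of [f] cancel by linearity, so the parallelogram law passes from the squared
   norm to [J]. *)
have J_par x y : complex.Re (`|x - y| ^+ 2) =
    2 * J x + 2 * J y - 4 * J (2^-1 *: (x + y)).
  have : `|x - y| ^+ 2 = 2 * j x + 2 * j y - 4 * j (2^-1 *: (x + y)).
    by rewrite parallelogram /j fZ fD; field.
  by move=> ->; rewrite raddfB raddfD /= !Re_natM.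
pose F := filter_from [set e : R | 0 < e] (fun e => [set x | J x < m + e]).
have FF : ProperFilter F.
  apply: filter_from_proper; last by move=> e /m_adh.
  apply: filter_from_filter; first by exists 1; exact: ltr01.
  move=> a b /= a0 b0; exists (Num.min a b); first by rewrite /= lt_min a0 b0.
  by move=> x /=; rewrite -!ltrBlDl lt_min => /andP[].
have /cauchy_cvgP/cvg_ex[z Fz] : cauchy F.
  apply: cauchy_exP => e e0.
  have e2 : 0 < complex.Re (e ^+ 2) by rewrite Re_gt0// exprn_gt0.
  (* If [J x] and [J y] are below [m + e^2 / 4], then, as [J] is at least [m] at the midpoint,
     [J_par] gives [|x - y|^2 < e^2]. *)
  have d0 : 0 < complex.Re (e ^+ 2) / 4 by rewrite divr_gt0.
  have [x Jx] := m_adh _ d0.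
  exists x, (complex.Re (e ^+ 2) / 4) => //= y /= Jy.
  rewrite -ball_normE /= -ltr_sqr ?nnegrE ?normr_ge0 ?ltW//.
  apply: Re_lt_real; rewrite ?realX ?normr_real ?gtr0_real//.
  rewrite J_par; have := mJ (2^-1 *: (x + y)); lra.
have Jz x : J z <= J x.
  apply: le_trans (mJ x); rewrite leNgt; apply/negP => mz.
  have JF : J y @[y --> F] --> J z.
    apply: Re_cvg; apply: cvgB.
      by rewrite expr2; apply: cvgM; apply: cvg_norm.
    by apply: cvgMr; apply: cvg_comp Fz _; exact: cf.
  have d0 : 0 < (J z - m) / 2 by rewrite divr_gt0 ?subr_gt0.
  have F1 : F [set x | J x < m + (J z - m) / 2] by exists ((J z - m) / 2).
  have /cvgrPdist_lt/(_ _ d0) F2 := JF.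
  have [y [/= y1]] := filter_ex (filterI F1 F2).
  rewrite ltr_norml => /andP[_]; lra.
(* If the defect [p] at [h] were nonzero, moving from the minimizer [z] by [v], a multiple of [h]
   with coefficient [t * p^*], would lower [J]. The choice of [t] makes [t * |h|^2 < 1], so the
   quadratic term cannot offset the gain. *)
exists z => h; apply/eqP; rewrite -subr_eq0; apply/negP => /negP psi0.
pose p : Cplx R := f h - inner h z.
pose t : Cplx R := (1 + `|h| ^+ 2)^-1.
have h1 : 0 < 1 + `|h| ^+ 2 by rewrite ltr_wpDr// exprn_ge0.
have t0 : 0 < t by rewrite invr_gt0.
have tJ : t^* = t by apply/CrealP; rewrite gtr0_real.
pose v := (t * p^*) *: h.
(* The bracketed difference is purely imaginary and disappears in [J]. *)
have jv : j (z + v) =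
    j z + ((inner v z)^* - inner v z) + t * `|p| ^+ 2 * (t * `|h| ^+ 2 - 2).
  rewrite /j -inner_conj -!innerxx fD innerDl !innerDr fZ !(innerZl, innerZr).
  have -> : (t * p^*)^* = t * p by rewrite rmorphM /= conjCK tJ.
  have -> : f h = p + inner h z by rewrite subrK.
  by rewrite normCK; ring.
have : complex.Re (t * `|p| ^+ 2 * (t * `|h| ^+ 2 - 2)) < complex.Re 0.
  have : t * `|p| ^+ 2 * (t * `|h| ^+ 2 - 2) < 0.
    rewrite pmulr_rlt0 ?mulr_gt0 ?exprn_gt0 ?normr_gt0//.
    rewrite subr_lt0 mulrC ltr_pdivrMr// mulrDr mulr1 ltr_pwDl//.
    by rewrite ler_peMl ?exprn_ge0// ler1n.
  by rewrite ltcE => /andP[].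
have := Jz (z + v); rewrite /J jv !raddfD raddfN /=.
have -> : complex.Re (inner v z)^* = complex.Re (inner v z).
  by case: (inner v z).
lra.
Qed.

End Inner.

(** * Adjoints, isometries and unitaries *)

Section Adjoint.
Context {R : realType} {H : hilbertType R}.
Implicit Types (X Y : bop H H) (x y : H).

Lemma bop_bound X :
  exists2 C : Cplx R, 0 < C & forall x, `|X x| <= C * `|x|.
Proof.
have [_ cX] := bopP X.
have /linear_boundedP/pinfty_ex_gt0[C C0 XC] : bounded_near X (nbhs 0).
  by apply: continuous_linear_bounded; exact: cX.
by exists C.
Qed.

(** Riesz representation yields [Y y] for each [y] separately; uniqueness of the representing vector
    makes [Y] linear, and Cauchy-Schwarz applied to [|Y y|^2 = <X (Y y), y>] bounds it by any bound
    of [X]. *)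
Lemma adj_exists X :
  exists Y : bop H H, forall x y, inner (X x) y = inner x (Y y).
Proof.
have [lX cX] := bopP X.
have /choice[Y XY] y : exists z, forall x, inner (X x) y = inner x z.
  apply: (@riesz_representation _ _ (fun x => inner (X x) y)).
    by move=> a u v; rewrite lX innerDl innerZl.
  by move=> x; apply: inner_cvgl; exact: cX.
have lY : linear Y.
  move=> a u v; apply: inner_inj => x.
  by rewrite -XY !innerDr !innerZr !XY.
have [C C0 XC] := bop_bound X.
have YC y : `|Y y| <= C * `|y|.
  have [->|Yy0] := eqVneq (Y y) 0; first by rewrite normr0 mulr_ge0// ltW.
  have Yy : 0 < `|Y y| by rewrite normr_gt0.
  rewrite -(ler_pM2l Yy) -expr2 -innerxx -XY.
  rewrite -[leLHS]ger0_norm; last by rewrite XY innerxx exprn_ge0.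
  rewrite (le_trans (inner_Cauchy_Schwarz _ _))//.
  by rewrite mulrA ler_wpM2r// mulrC XC.
have cY : continuous Y.
  pose Y' := HB.pack_for {linear H -> H} Y (GRing.isLinear.Build _ _ _ _ _ lY).
  apply: (@bounded_linear_continuous _ _ _ Y').
  apply/linear_boundedP; exists C; split; first exact: gtr0_real.
  move=> M CM y /=; apply: le_trans (YC y) _.
  by rewrite ler_wpM2r// ltW.
have bY : Y \in @bounded_linear _ H H by apply/mem_set.
by exists (Bop bY).
Qed.

(** By [adj_exists], the choice defining [adj] never falls back on its default value 0. *)
Lemma inner_adjr X x y : inner x (adj X y) = inner (X x) y.
Proof.
have [Y XY] := adj_exists X.
by rewrite /adj; case: xgetP => [Z _ /= ->//|/(_ Y)].
Qed.

Lemma inner_adjl X x y : inner (adj X x) y = inner x (X y).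
Proof. by rewrite inner_conj inner_adjr -inner_conj. Qed.

Lemma adjM X Y : adj (X * Y) = adj Y * adj X.
Proof.
apply: bop_ext => y; apply: inner_inj => x.
by rewrite inner_adjr /= !inner_adjr.
Qed.

(** Polarization: preservation of the norm of [c *: y + x] for every scalar [c] forces preservation
    of inner products. *)
Lemma adj_mul_eq1 X : (forall x, `|X x| = `|x|) -> adj X * X = 1.
Proof.
move=> isoX; have [lX _] := bopP X.
have sesqui x y c : c^* * inner (X x) (X y) + c * inner (X y) (X x) =
    c^* * inner x y + c * inner y x.
  have : inner (X (c *: y + x)) (X (c *: y + x)) =
      inner (c *: y + x) (c *: y + x) by rewrite !innerxx isoX.
  rewrite lX !(innerDl, innerDr, innerZl, innerZr) !innerxx !isoX.
  by move/eqP; rewrite -subr_eq0 => /eqP E; apply: subr0_eq; rewrite -E; ring.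
apply: bop_ext => y; apply: inner_inj => x.
rewrite inner_adjr; apply/eqP; rewrite -subr_eq0.
(* Taking for [c] the defect [<X x, X y> - <x, y>] itself turns the polarized identity into
   [2 * |d|^2 = 0]. *)
set d := _ - _; have := sesqui x y d.
rewrite [inner (X y) _]inner_conj [inner y _]inner_conj => E.
have : 2 * `|d| ^+ 2 = 0.
  move/eqP: E; rewrite -subr_eq0 => /eqP <-.
  by rewrite normCK rmorphB /= /d; ring.
move=> /eqP; rewrite mulf_eq0 pnatr_eq0 /= sqrf_eq0 normr_eq0//.
Qed.

Lemma unitary_adj_norm X x : unitary X -> `|adj X x| = `|x|.
Proof.
move=> [_ XX1]; apply/eqP; rewrite -(@eqrXn2 _ 2)// -!innerxx inner_adjl.
by rewrite -[X (adj X x)]/((X * adj X) x) XX1.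
Qed.

End Adjoint.

(** * Dominated convergence of series *)

Section Series.

Lemma cvg_series_tail (K : numFieldType) (b : nat -> K) :
  cvgn (series b) -> forall e, 0 < e ->
  exists N, forall n, (N <= n)%N -> `|\sum_(N <= k < n) b k| < e.
Proof.
move=> /cvg_cauchy/cauchy_seriesP bc e /bc[[A B] /= [[NA _ hA] [NB _ hB]] hAB].
exists (maxn NA NB) => n Nn; apply: (hAB (_, n)); split => /=.
  by apply: hA; exact: leq_maxl.
by apply: hB; apply: leq_trans Nn; exact: leq_maxr.
Qed.

(* Tannery's theorem. *)
Lemma cvg_series_dominated (K : numFieldType) (T : Type) (F : set_system T)
    (FF : Filter F) (a : T -> nat -> K) (l b : nat -> K) :
  (forall n, a t n @[t --> F] --> l n) ->
  (\forall t \near F, forall n, `|a t n| <= b n) ->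
  (forall n, `|l n| <= b n) -> cvgn (series b) ->
  (\forall t \near F, cvgn (series (a t))) -> cvgn (series l) ->
  limn (series (a t)) @[t --> F] --> limn (series l).
Proof.
move=> al ab lb bc ac lc; apply/cvgrPdist_lt => e e0.
have e5 : 0 < e / 5 by rewrite divr_gt0.
have [N bN] := cvg_series_tail bc e5.
(* One fifth is spent between the limit and a late partial sum, another on the block from [N] to
   that sum. The two tails and the head thus use all five fifths of [e]. *)
have tail (c : nat -> K) : (forall n, `|c n| <= b n) -> cvgn (series c) ->
    `|limn (series c) - series c N| < e / 5 + e / 5.
  move=> cb /[dup] cc /cvgrPdist_lt/(_ _ e5)[M _ hM].
  rewrite -(subrKA (series c (maxn N M))) (le_lt_trans (ler_normD _ _))//.
  rewrite ltrD//; first by apply: hM; exact: leq_maxr.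
  rewrite sub_series_geq ?leq_maxl//.
  apply: le_lt_trans (bN _ (leq_maxl N M)).
  rewrite (le_trans (ler_norm_sum _ _ _))// [leRHS]ger0_norm; last first.
    by apply: sumr_ge0 => k _; apply: le_trans (cb k).
  by apply: ler_sum.
have aN : series (a t) N @[t --> F] --> series l N.
  rewrite /series /=; elim: N {bN tail} => [|n IH].
    rewrite big_geq//; under eq_fun do rewrite big_geq//.
    exact: cvg_cst.
  rewrite big_nat_recr//=; under eq_fun do rewrite big_nat_recr//=.
  exact: cvgD.
move/cvgrPdist_lt/(_ _ e5) : aN => aN.
near=> t.
have -> : limn (series l) - limn (series (a t)) = (limn (series l) - series l N)
    + (series l N - series (a t) N) - (limn (series (a t)) - series (a t) N).
  by ring.
have -> : e = (e / 5 + e / 5) + (e / 5) + (e / 5 + e / 5) by field.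
rewrite (le_lt_trans (ler_normB _ _))// ltrD//.
  rewrite (le_lt_trans (ler_normD _ _))// ltrD//; first exact: tail.
  by near: t.
by apply: tail; [near: t|near: t].
Unshelve. all: by end_near. Qed.

(* Completeness of the complex numbers, borrowed from that of a nonzero Hilbert
   space. *)
Lemma cvg_series_le (R : realType) (H : hilbertType R) (e : H)
    (c b : nat -> Cplx R) : e != 0 ->
  (forall n, `|c n| <= b n) -> cvgn (series b) -> cvgn (series c).
Proof.
move=> e0 cb bc; have en : 0 < `|e| by rewrite normr_gt0.
have /cauchy_cvgP/cvg_ex[h ch] : cauchy (series (fun n => c n *: e) @ \oo).
  apply/cauchy_seriesP => d d0.
  have /cvg_cauchy/cauchy_seriesP/(_ _ (divr_gt0 d0 en)) := bc.
  apply: filterS => -[m n] /=; rewrite ltr_pdivlMr//; apply: le_lt_trans.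
  rewrite -scaler_suml normrZ ler_wpM2r//.
  rewrite (le_trans (ler_norm_sum _ _ _))// [leRHS]ger0_norm; last first.
    by apply: sumr_ge0 => k _; apply: le_trans (cb k).
  by apply: ler_sum.
(* The scalar limit is the coefficient of [h] along [e]. *)
apply/cvg_ex; exists (inner h e / inner e e).
have ee : inner e e != 0 by rewrite innerxx expf_neq0// normr_eq0.
have -> : series c = fun n => inner (series (fun n => c n *: e) n) e / inner e e.
  apply/funext => n.
  by rewrite /series /= -scaler_suml innerZl mulfK.
by apply: cvgMl; apply: inner_cvgl.
Qed.

End Series.

(** * Convergence in the weak* topology *)

Lemma cvg_initial (S : choiceType) (T : topologicalType) (f : S -> T)
    (F : set_system S) (FF : Filter F) (s : S) :
  f x @[x --> F] --> f s -> F --> (s : initial_topology f).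
Proof.
move=> fs A /= [_ [[B oB <-] Bs BA]]; rewrite nbhs_simpl.
by apply: filterS BA _; apply: fs; exact: open_nbhs_nbhs.
Qed.

Lemma cvg_series_head (K : numFieldType) (c : K) :
  series (fun n => if n == 0%N then c else 0) @ \oo --> c.
Proof.
apply: cvg_near_cst; exists 1%N => // n /= n0.
by rewrite /series /= big_ltn//= big_nat big1 ?addr0// => i /andP[]; case: i.
Qed.

Section WeakStar.
Context {R : realType} {H : hilbertType R}.
Implicit Types (w X : bop H H) (x y : H).

(** The topology is initial for a map into a product, which is itself initial for its projections;
    hence the two uses of [cvg_initial]. *)
Lemma wstar_cvg (T : Type) (F : set_system T) (FF : Filter F)
    (X : T -> bop H H) w :
  (forall p, normal_functional p (X t) @[t --> F] --> normal_functional p w) ->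
  X t @[t --> F] --> (w : wstar H).
Proof.
move=> Xw; apply: cvg_initial; apply/cvg_sup => p.
by apply: cvg_initial; exact: Xw.
Qed.

Lemma normal_functional_continuous p :
  continuous (normal_functional p : wstar H -> Cplx R).
Proof.
move=> X.
pose f (X : bop H H) : {ptws _ -> Cplx R} := fun p => normal_functional p X.
have /cvg_sup/(_ p) fX : f Y @[Y --> (X : wstar H)] --> f X.
  exact: initial_continuous.
move=> A AX; apply: (fX _ (@proj _ (fun=> Cplx R) p @^-1` A)).
  by apply: fmap_filter; exact: (@nbhs_filter (wstar H)).
exact: (@initial_continuous _ _ (@proj _ (fun=> Cplx R) p)).
Qed.

(** Matrix coefficients are normal: take the sequences equal to [x] and [y] at index 0 and to zero
    elsewhere. *)
Lemma inner_normal_functional x y :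
  exists p, forall X, normal_functional p X = inner (X x) y.
Proof.
pose d (z : H) n := if n == 0%N then z else 0.
have dsum z : square_summable (d z).
  rewrite /square_summable; apply/cvg_ex; exists (`|z| ^+ 2).
  have -> : (fun n => `|d z n| ^+ 2) =
      fun n => if n == 0%N then `|z| ^+ 2 else 0.
    by apply/funext => -[|n] //=; rewrite normr0 expr0n.
  exact: cvg_series_head.
exists (exist _ (d x, d y) (conj (dsum x) (dsum y))) => X.
apply: cvg_lim => //=.
have -> : (fun n => inner (X (d x n)) (d y n)) =
    fun n => if n == 0%N then inner (X x) y else 0.
  apply/funext => -[|n] //=.
  by rewrite /d /= -(scale0r (0 : H)) innerZr conjC0 mul0r.
exact: cvg_series_head.
Qed.

(** Strong convergence gives convergence of each term of a normal functional, and contractivity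
    gives the summable bound [|x n|^2 + |y n|^2] uniformly, so dominated convergence applies. *)
Lemma contraction_sot_wstar (T : Type) (F : set_system T) (FF : ProperFilter F)
    (X : T -> bop H H) w :
  (forall x, X t x @[t --> F] --> w x) ->
  (\forall t \near F, forall x, `|X t x| <= `|x|) ->
  (forall x, `|w x| <= `|x|) ->
  X t @[t --> F] --> (w : wstar H).
Proof.
move=> Xw X1 w1; apply: wstar_cvg => -[[x y] [/= sx sy]].
have dom (Y : bop H H) : (forall x, `|Y x| <= `|x|) ->
    forall n, `|inner (Y (x n)) (y n)| <= `|x n| ^+ 2 + `|y n| ^+ 2 :> Cplx R.
  move=> Y1 n; apply: le_trans (inner_Cauchy_Schwarz _ _) _.
  apply: (@le_trans _ _ (`|x n| * `|y n|)); first by rewrite ler_wpM2r.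
  have : 0 <= (`|x n| - `|y n|) ^+ 2.
    by rewrite real_exprn_even_ge0// rpredB ?normr_real.
  rewrite sqrrB -addrA [- _ + _]addrC addrA subr_ge0; apply: le_trans.
  by rewrite mulr2n lerDl mulr_ge0.
have sxy : cvgn (series (fun n => `|x n| ^+ 2 + `|y n| ^+ 2 : Cplx R)).
  have [[a xa] [b yb]] := ((cvg_ex _).1 sx, (cvg_ex _).1 sy).
  apply/cvg_ex; exists (a + b).
  have -> : series (fun n => `|x n| ^+ 2 + `|y n| ^+ 2 : Cplx R) =
      fun n => series (fun n => `|x n| ^+ 2) n + series (fun n => `|y n| ^+ 2) n.
    by apply/funext => n; rewrite /series /= big_split.
  exact: (cvgD xa yb).
have sum (Y : bop H H) : (forall x, `|Y x| <= `|x|) ->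
    cvgn (series (fun n => inner (Y (x n)) (y n))).
  (* [cvg_series_le] requires a nonzero vector, which some [x n] supplies unless the whole series
     vanishes. *)
  move=> Y1; have [[n xn0]|x0] := pselect (exists n, x n != 0).
    exact: cvg_series_le xn0 (dom _ Y1) sxy.
  have -> : series (fun n => inner (Y (x n)) (y n)) = fun=> 0.
    apply/funext => n; rewrite /series /= big1// => k _.
    have [->|xk0] := eqVneq (x k) 0; last by case: x0; exists k.
    by rewrite linear0 -(scale0r (0 : H)) innerZl mul0r.
  exact: is_cvg_cst.
apply: (@cvg_series_dominated _ _ _ _ _ _ _ _ _ (dom _ w1) sxy).
- by move=> n; apply: inner_cvgl; exact: Xw.
- by apply: filterS X1 => t /dom.
- by apply: filterS X1 => t /sum.
- exact: sum.
Qed.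

End WeakStar.

(** * Limits of adjoint cocycles *)

Section Cocycle.
Context {R : realType} {H : hilbertType R}.
Context (G : R -> bop H H -> bop H H) (u : R -> bop H H) (w : bop H H).
Context (u_cocycle : cocycle G u) (u_lim : adj_sot_limit u w).

(** The norm is continuous, and [|adj (u t) x|] equals [|x|] as soon as [t >= 0]. *)
Lemma adj_sot_limit_isometry x : `|w x| = `|x|.
Proof.
have wx : `|adj (u t) x| @[t --> +oo] --> `|w x|.
  by apply: cvg_norm; exact: u_lim.
suff : `|adj (u t) x| @[t --> +oo] --> `|x|.
  by apply: cvg_unique wx; exact: norm_hausdorff.
apply: cvg_near_cst; near=> t.
by apply: unitary_adj_norm; apply: (cocycle_unitary u_cocycle).
Unshelve. all: by end_near. Qed.

Lemma adj_sot_limit_wstar : adj (u t) @[t --> +oo] --> (w : wstar H).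
Proof.
apply: contraction_sot_wstar => //; last first.
  by move=> x; rewrite adj_sot_limit_isometry.
near=> t => x; rewrite unitary_adj_norm//.
exact: (cocycle_unitary u_cocycle).
Unshelve. all: by end_near. Qed.

(** [G t] is only known to be weak* continuous, so the limit [s -> +oo] is taken in matrix
    coefficients, where both sides are limits of the same function. *)
Lemma adj_sot_limit_shift (t : R) : 0 <= t -> normal_star_endo (G t) ->
  w = G t w * adj (u t).
Proof.
move=> t0 Gt; apply: bop_ext => x; apply: inner_inj => y.
(* Conjugation moves the operators to the first argument, as in normal functionals. *)
rewrite inner_conj [RHS]inner_conj; congr Num.conj.
have lim1 : inner (adj (u (s + t)) x) y @[s --> +oo] --> inner (w x) y.
  apply: inner_cvgl.
  by rewrite (cvg_shiftr t (fun s => adj (u s) x)); exact: u_lim.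
suff : inner (adj (u (s + t)) x) y @[s --> +oo] -->
    inner ((G t w * adj (u t)) x) y.
  by apply: cvg_unique lim1; exact: norm_hausdorff.
(* The vector [adj (u t) x] does not depend on [s], so it can be absorbed into the functional. *)
have [p pE] := inner_normal_functional (adj (u t) x) y.
have lim2 : normal_functional p (G t (adj (u s))) @[s --> +oo] -->
    normal_functional p (G t w).
  have GX : G t (adj (u s)) @[s --> +oo] --> (G t w : wstar H).
    by move=> A /(nse_normal Gt) GA; exact: adj_sot_limit_wstar GA.
  exact: (cvg_comp _ _ GX (@normal_functional_continuous _ _ p (G t w))).
rewrite -[inner (_ x) y]pE; apply: cvg_trans lim2; apply: near_eq_cvg.
(* The cocycle identity is available once [s >= 0]. *)
near=> s; rewrite pE addrC (cocycleD u_cocycle)// adjM.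
by rewrite (nse_star Gt).
Unshelve. all: by end_near. Qed.

End Cocycle.

Unset Implicit Arguments.

Theorem proposition3p2 (R : realType) (H K : hilbertType R)
  (HK : hilbert_tensor H K) (d : H)
  (g : R -> bop K K -> bop K K) (G : R -> bop HK HK -> bop HK HK)
  (u : R -> bop HK HK) (w : bop HK HK)
  (sepH : separable_space H) (sepK : separable_space K)
  (d1 : `|d| = 1)
  (g_E0 : E0_semigroup g)
  (G_amp : forall t : R, 0 <= t -> amplification HK (g t) (G t))
  (u_cocycle : cocycle G u)
  (u_conv : convergent u)
  (u_lim : adj_sot_limit u w)
  (w_range : w * adj w = proj_slice HK d) :
  exact_cocycle HK d G u.
Proof.
have ww : adj w * w = 1.
  by apply: adj_mul_eq1; exact: adj_sot_limit_isometry u_cocycle u_lim.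
exists w; split=> // t t0.
have [uu _] := cocycle_unitary u_cocycle t0.
have wGu := adj_sot_limit_shift u_cocycle u_lim t0 (G_amp t t0).1.
(* Multiplying the shift identity on the right by [u t] cancels [adj (u t)]. *)
have -> : G t w = w * u t by rewrite {2}wGu -mulrA uu mulr1.
by rewrite mulrA ww mul1r.
Qed.
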